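(* Let $T \in \mathbb{N} \cup \{+\infty\}$ and let $\mathbb{N}_{\le T} = \{0,1,\dots,T\}$ (with $\mathbb{N}_{\le T} = \mathbb{N}$ if $T = +\infty$) and $\mathbb{N}_{\le T-1}$ defined analogously. Consider random regressors $M_t \in \mathbb{R}^{m \times n}$, outputs $y_{t+1} \in \mathbb{R}^m$ and noise vectors $w_t \in \mathbb{R}^m$ satisfying $y_{t+1} = M_t \theta^\star + w_t$ for $t \in \mathbb{N}_{\le T-1}$, where $\theta^\star \in \mathbb{R}^n$ is a deterministic vector. Let $\mathcal{D}_t = \{M_0, y_1, M_1, \dots, y_t, M_t\}$, let $W \succ 0$ be a symmetric positive definite $m\times m$ matrix, and define $$V_t = \sum_{k=0}^{t-1} M_k^\top W M_k, \qquad s_t = \sum_{k=0}^{t-1} M_k^\top W w_k.$$ Assume that for a known constant $c_w > 0$ and all $t \in \mathbb{N}_{\le T-1}$, $$\forall \nu \in \mathbb{R}^m,\quad \mathbb{E}\left[e^{\nu^\top w_t} \mid \mathcal{D}_t\right] \le e^{\frac12 c_w^2 \nu^\top W^{-1} \nu}.$$ Let $z \in \mathbb{R}^n$, let $\bar P \in \mathbb{R}^{n\times n}$ be symmetric positive definite, and let $\delta \in (0,1)$. Then, with probability at least $1-\delta$, for all $t \in \mathbb{N}_{\le T}$ simultaneously, $$\|z + s_t\|^2_{(\bar P + V_t)^{-1}} \le \|z\|^2_{\bar P^{-1}} + c_w^2\left(\log\left|I_n + \bar P^{-1} V_t\right| + 2\log(1/\delta)\right).$$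
   Context: For a symmetric positive definite matrix $A$, $\|x\|_A^2 = x^\top A x$. $|A|$ denotes the determinant of a square matrix $A$. *)

(* Defs.v *)
From HB Require Import structures.
From mathcomp Require Import all_boot all_order all_algebra.
From mathcomp Require Import all_classical all_reals all_analysis.
Set Implicit Arguments. Unset Strict Implicit. Unset Printing Implicit Defensive.
Import Order.TTheory GRing.Theory Num.Theory.
Import numFieldNormedType.Exports.
Local Open Scope classical_set_scope.
Local Open Scope ring_scope.

(* Horizon T in N ∪ {+oo}: [None] encodes +oo. *)
Definition leT (T : option nat) (t : nat) : bool :=
  if T is Some T' then (t <= T')%N else true.
Definition leT1 (T : option nat) (t : nat) : bool :=
  if T is Some T' then (t < T')%N else true.

Definition qform {R : ringType} {n : nat} (A : 'M[R]_n) (x : 'cV[R]_n) : R :=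
  (x^T *m A *m x) 0 0.

Definition spd {R : numDomainType} {n : nat} (A : 'M[R]_n) : Prop :=
  A^T = A /\ forall x : 'cV[R]_n, x != 0 -> 0 < qform A x.

Definition gen_Dt {d} {Om : measurableType d} {R : realType} {m n : nat}
  (M : nat -> Om -> 'M[R]_(m, n)) (y : nat -> Om -> 'cV[R]_m) (t : nat)
  : set (set Om) :=
  [set A | (exists k (i : 'I_m) (j : 'I_n) (B : set R),
              (k <= t)%N /\ measurable B /\ A = (fun om => M k om i j) @^-1` B)
        \/ (exists k (i : 'I_m) (B : set R),
              (1 <= k <= t)%N /\ measurable B /\ A = (fun om => y k om i 0) @^-1` B)].

Definition Dt {d} {Om : measurableType d} {R : realType} {m n : nat}
  (M : nat -> Om -> 'M[R]_(m, n)) (y : nat -> Om -> 'cV[R]_m) (t : nat)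
  : set (set Om) := <<s gen_Dt M y t >>.

(* E[X | G] <= c almost surely, for a nonnegative X, stated through the
   defining property of conditional expectation:
   for every A in G, E[X 1_A] <= c P(A). *)
Definition cond_exp_le {d} {Om : measurableType d} {R : realType}
  (P : probability Om R) (G : set (set Om)) (X : Om -> R) (c : R) : Prop :=
  forall A, G A -> (\int[P]_(om in A) (X om)%:E <= c%:E * P A)%E.

Definition Vt {R : ringType} {m n : nat} (W : 'M[R]_m) (Mt : nat -> 'M[R]_(m, n))
  (t : nat) : 'M[R]_n := \sum_(k < t) ((Mt k)^T *m W *m Mt k).
Definition st {R : ringType} {m n : nat} (W : 'M[R]_m) (Mt : nat -> 'M[R]_(m, n))
  (wt : nat -> 'cV[R]_m) (t : nat) : 'cV[R]_n :=
  \sum_(k < t) ((Mt k)^T *m W *m wt k).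

(* Main.v *)
Require Import Defs.
From HB Require Import structures.
From mathcomp Require Import all_boot all_order all_algebra.
From mathcomp Require Import all_classical all_reals all_analysis.
From mathcomp Require Import measurable_realfun ring lra.
Set Implicit Arguments. Unset Strict Implicit. Unset Printing Implicit Defensive.
Import Order.TTheory GRing.Theory Num.Theory.
Import numFieldNormedType.Exports.
Local Open Scope classical_set_scope.
Local Open Scope ring_scope.

(** The argument is the method of mixtures.  For a fixed direction v, the sub-Gaussian
    hypothesis makes exp(v^T (z + s_t) / cw - v^T (Pbar + V_t) v / 2) a supermartingale; this
    needs the hypothesis for the random, D_t-measurable direction W M_t v / cw, which is
    obtained by rounding to a grid and passing to the limit.  Integrating over v yields, up to
    a constant, the supermartingale
      Z_t = det(Pbar + V_t)^(-1/2) exp(|z + s_t|^2_{(Pbar + V_t)^-1} / (2 cw^2)).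
    Ville's maximal inequality bounds by delta the probability that some Z_t exceeds
    Z_0 / delta, and Z_t <= Z_0 / delta is the claimed bound after taking logarithms. *)

(** * Schur complements of positive definite matrices: eliminating one coordinate *)

Section Schur.
Variables (F : realFieldType) (n : nat).
Implicit Types (A : 'M[F]_(1 + n)) (b : 'cV[F]_(1 + n)).

(** The upper right block is replaced by the transpose of the lower left one, so this is the usual
    Schur complement of the top left entry only for symmetric [A]. The size [1 + n] serves
    inductions that remove one coordinate at a time. *)
Definition schur A : 'M[F]_n :=
  drsubmx A - (ulsubmx A 0 0)^-1 *: (dlsubmx A *m (dlsubmx A)^T).

(** Right-hand side left for the last [n] unknowns of [A x = b] after eliminating the first one. *)
Definition schur_vec A b : 'cV[F]_n :=
  dsubmx b - ((ulsubmx A 0 0)^-1 * usubmx b 0 0) *: dlsubmx A.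

Lemma sym_block A : A^T = A ->
  A = block_mx (ulsubmx A 0 0)%:M (dlsubmx A)^T (dlsubmx A) (drsubmx A).
Proof.
move=> As; rewrite -[in LHS](submxK A) -mx11_scalar; congr block_mx.
by rewrite trmx_dlsub As.
Qed.

Lemma trmul00 (u v : 'cV[F]_n) : (u^T *m v) 0 0 = (v^T *m u) 0 0.
Proof. by rewrite -[u^T *m v]trmxK trmx_mul trmxK mxE. Qed.

Lemma qform_block (a : F) (u : 'cV[F]_n) (B : 'M[F]_n) (x : F) (v : 'cV[F]_n) :
  qform (block_mx a%:M u^T u B) (col_mx x%:M v) =
  a * x ^+ 2 + 2 * x * (v^T *m u) 0 0 + qform B v.
Proof.
have D (X Y : 'M[F]_1) : (X + Y) 0 0 = X 0 0 + Y 0 0 by rewrite mxE.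
have Z (k : F) (X : 'M[F]_1) : (k *: X) 0 0 = k * X 0 0 by rewrite mxE.
rewrite /qform tr_col_mx mul_row_block mul_row_col !mulmxDl !D.
rewrite tr_scalar_mx !mul_mx_scalar !mul_scalar_mx -!scalemxAl !Z (trmul00 u).
by rewrite !mxE eqxx /=; ring.
Qed.

Lemma qform_dot_sqr (u v : 'cV[F]_n) : qform (u *m u^T) v = (v^T *m u) 0 0 ^+ 2.
Proof.
rewrite /qform mulmxA -mulmxA [LHS]mxE big_ord1 (trmul00 u) expr2.
by congr (_ * _).
Qed.

Lemma qformB (A B : 'M[F]_n) (v : 'cV[F]_n) :
  qform (A - B) v = qform A v - qform B v.
Proof. by rewrite /qform mulmxBr mulmxBl !mxE. Qed.

Lemma qformZ (k : F) (A : 'M[F]_n) (v : 'cV[F]_n) :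
  qform (k *: A) v = k * qform A v.
Proof. by rewrite /qform -scalemxAr -scalemxAl mxE. Qed.

Lemma spd_ul_gt0 A : spd A -> 0 < ulsubmx A 0 0.
Proof.
move=> [As Ap].
have := Ap (col_mx 1%:M 0); rewrite {1}(sym_block As) qform_block.
rewrite /qform trmx0 !mul0mx !mxE expr1n !mulr1 mulr0 !addr0; apply.
apply/eqP => /(congr1 usubmx); rewrite col_mxKu => /matrixP/(_ 0 0).
by rewrite !mxE eqxx /= => /eqP; rewrite oner_eq0.
Qed.

(** Completing the square in the first coordinate leaves the Schur complement as the form in the
    others. *)
Lemma qform_schur A (x : F) (v : 'cV[F]_n) : A^T = A -> ulsubmx A 0 0 != 0 ->
  qform A (col_mx x%:M v) = qform (schur A) v +
    ulsubmx A 0 0 * (x + (ulsubmx A 0 0)^-1 * (v^T *m dlsubmx A) 0 0) ^+ 2.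
Proof.
move=> As a0; rewrite {1}(sym_block As) qform_block /schur qformB qformZ qform_dot_sqr.
by field.
Qed.

(** Given [v], choose the first coordinate that makes the square in [qform_schur] vanish; positivity
    of [A] at the extended vector is then positivity of [schur A] at [v]. *)
Lemma spd_schur A : spd A -> spd (schur A).
Proof.
move=> sA; have a0 := spd_ul_gt0 sA; case: sA => As Ap; split.
  rewrite /schur linearB linearZ /= trmx_mul trmxK; congr (_ - _).
  by rewrite trmx_drsub As.
move=> v v0.
have := Ap (col_mx (- ((ulsubmx A 0 0)^-1 * (v^T *m dlsubmx A) 0 0))%:M v).
rewrite qform_schur ?gt_eqF// addNr expr0n mulr0 addr0; apply.
by apply: contra v0 => /eqP/(congr1 dsubmx); rewrite col_mxKd => ->; rewrite linear0.
Qed.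

(** One step of Gaussian elimination: [A] is a unit lower triangular block matrix times an upper
    triangular one with diagonal blocks the pivot and [schur A]. *)
Lemma det_schur A : spd A -> \det A = ulsubmx A 0 0 * \det (schur A).
Proof.
move=> sA; have a0 := spd_ul_gt0 sA; case: sA => As _.
set a := ulsubmx A 0 0; set u := dlsubmx A.
have E : A = block_mx 1%:M 0 (a^-1 *: u) 1%:M *m block_mx a%:M u^T 0 (schur A).
  rewrite {1}(sym_block As) mulmx_block !mul1mx !mul0mx !addr0.
  rewrite mul_mx_scalar scalerA mulfV ?gt_eqF// scale1r -scalemxAl.
  by rewrite /schur addrC subrK.
by rewrite [in LHS]E det_mulmx det_lblock det_ublock !det1 !mul1r det_scalar expr1.
Qed.

End Schur.

Lemma spd_det_gt0 (F : realFieldType) n (A : 'M[F]_n) : spd A -> 0 < \det A.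
Proof.
elim: n A => [|n IH] A sA; first by rewrite det_mx00.
by rewrite (@det_schur _ n)// mulr_gt0 ?spd_ul_gt0//; exact/IH/spd_schur.
Qed.

Lemma spd_unit (F : realFieldType) n (A : 'M[F]_n) : spd A -> A \in unitmx.
Proof. by move=> /spd_det_gt0 A0; rewrite unitmxE unitfE gt_eqF. Qed.

Lemma qform_inv (F : realFieldType) n (A : 'M[F]_n) (b x : 'cV[F]_n) : spd A ->
  A *m x = b -> qform (invmx A) b = (b^T *m x) 0 0.
Proof.
by move=> sA <-; rewrite /qform -mulmxA mulKmx ?spd_unit.
Qed.

(** Solve [A x = b] by elimination: the lower part [v] solves the system of [schur A], the top entry
    [x] follows by back substitution, and the form of the inverse is the product of [b] with this
    solution. *)
Lemma qform_inv_schur (F : realFieldType) n (A : 'M[F]_(1 + n)) (b : 'cV[F]_(1 + n)) :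
  spd A -> qform (invmx A) b =
    (ulsubmx A 0 0)^-1 * (usubmx b 0 0) ^+ 2
    + qform (invmx (schur A)) (schur_vec A b).
Proof.
move=> sA; have a0 := spd_ul_gt0 sA; have sS := spd_schur sA.
set a := ulsubmx A 0 0; set u := dlsubmx A; set b0 := usubmx b 0 0.
pose v := invmx (schur A) *m schur_vec A b.
pose x := a^-1 * (b0 - (v^T *m u) 0 0).
have Sv : schur A *m v = schur_vec A b by rewrite mulKVmx ?spd_unit.
have uv : u^T *m v = ((v^T *m u) 0 0)%:M.
  by rewrite [LHS]mx11_scalar trmul00.
rewrite (@qform_inv _ _ _ _ (col_mx x%:M v) sA); last first.
  rewrite (sym_block sA.1) mul_block_col -/a -/u -[RHS]vsubmxK; congr col_mx.
    rewrite uv -scalar_mxM /x mulrA mulfV ?gt_eqF// mul1r -raddfD /= subrK.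
    by rewrite [RHS]mx11_scalar.
  have -> : drsubmx A = schur A + a^-1 *: (u *m u^T) by rewrite /schur subrK.
  rewrite mulmxDl Sv -scalemxAl -mulmxA uv !mul_mx_scalar scalerA /schur_vec.
  rewrite -/a -/u -/b0 addrCA -scalerDl.
  have -> : x + a^-1 * (v^T *m u) 0 0 = a^-1 * b0 by rewrite /x mulrBr subrK.
  by rewrite subrK.
rewrite (qform_inv sS Sv) -{1}(vsubmxK b) tr_col_mx mul_row_col.
rewrite [usubmx b]mx11_scalar -/b0 tr_scalar_mx -scalar_mxM /schur_vec -/a -/u -/b0.
rewrite linearB linearZ /= mulmxBl -scalemxAl uv /x.
set c := (v^T *m u) 0 0; set e := (dsubmx b)^T *m v.
by rewrite !mxE eqxx /=; ring.
Qed.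

(** Prepares integration in [x] alone: the centre [mu] depends on [v], but the curvature [a] does
    not, so the one-dimensional Gaussian integral contributes a factor free of [v]. *)
Lemma complete_square (F : realFieldType) n (A : 'M[F]_(1 + n)) (b : 'cV[F]_(1 + n))
    (x : F) (v : 'cV[F]_n) :
  spd A ->
  let a := ulsubmx A 0 0 in
  let mu := a^-1 * (usubmx b 0 0 - (v^T *m dlsubmx A) 0 0) in
  ((col_mx x%:M v)^T *m b) 0 0 - 2^-1 * qform A (col_mx x%:M v) =
  2^-1 * (a^-1 * (usubmx b 0 0) ^+ 2)
  + ((v^T *m schur_vec A b) 0 0 - 2^-1 * qform (schur A) v)
  - 2^-1 * a * (x - mu) ^+ 2.
Proof.
move=> sA a mu; have a0 := spd_ul_gt0 sA; rewrite qform_schur ?gt_eqF//; last exact: sA.1.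
rewrite -{1}(vsubmxK b) tr_col_mx mul_row_col tr_scalar_mx.
rewrite [usubmx b]mx11_scalar -scalar_mxM /schur_vec mulmxBr -scalemxAr /mu -/a.
have a0' : a != 0 by rewrite gt_eqF.
set c := v^T *m dlsubmx A; set e := v^T *m dsubmx b.
by rewrite !mxE eqxx /= mulr1n; field.
Qed.

(** * Measurability of matrix-valued functions, entry by entry *)

Definition measurable_mx d (T : measurableType d) (R : realType) p q
  (f : T -> 'M[R]_(p, q)) :=
  forall i j, measurable_fun setT (fun x => f x i j).

Section MeasurableMx.
Context d (T : measurableType d) (R : realType).

Lemma measurable_mx_cst p q (C : 'M[R]_(p, q)) : measurable_mx (fun _ : T => C).
Proof. by move=> i j; exact: measurable_cst. Qed.

Lemma measurable_mxD p q (f g : T -> 'M[R]_(p, q)) :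
  measurable_mx f -> measurable_mx g -> measurable_mx (fun x => f x + g x).
Proof.
move=> mf mg i j; under eq_fun do rewrite mxE.
by apply: measurable_funD.
Qed.

Lemma measurable_mxZ p q (k : T -> R) (f : T -> 'M[R]_(p, q)) :
  measurable_fun setT k -> measurable_mx f -> measurable_mx (fun x => k x *: f x).
Proof.
move=> mk mf i j; under eq_fun do rewrite mxE.
by apply: measurable_funM.
Qed.

Lemma measurable_mxB p q (f g : T -> 'M[R]_(p, q)) :
  measurable_mx f -> measurable_mx g -> measurable_mx (fun x => f x - g x).
Proof.
move=> mf mg i j; under eq_fun do rewrite !mxE.
by apply: measurable_funB.
Qed.

Lemma measurable_mxM p q r (f : T -> 'M[R]_(p, q)) (g : T -> 'M[R]_(q, r)) :
  measurable_mx f -> measurable_mx g -> measurable_mx (fun x => f x *m g x).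
Proof.
move=> mf mg i j; under eq_fun do rewrite mxE.
by apply: measurable_sum => k; exact: measurable_funM.
Qed.

Lemma measurable_mx_tr p q (f : T -> 'M[R]_(p, q)) :
  measurable_mx f -> measurable_mx (fun x => (f x)^T).
Proof. by move=> mf i j; under eq_fun do rewrite mxE; exact: mf. Qed.

Lemma measurable_mx_sum p q (I : Type) (s : seq I) (f : I -> T -> 'M[R]_(p, q)) :
  (forall i, measurable_mx (f i)) -> measurable_mx (fun x => \sum_(i <- s) f i x).
Proof.
move=> mf i j; under eq_fun do rewrite summxE.
by apply: measurable_sum => k; exact: mf.
Qed.

Lemma measurable_det p (f : T -> 'M[R]_p) :
  measurable_mx f -> measurable_fun setT (fun x => \det (f x)).
Proof.
move=> mf; apply: measurable_sum => s; apply: measurable_funM => //.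
by apply: measurable_prod => i _; exact: mf.
Qed.

(** For positive [f] the inverse is [expR (- ln f)], a composition of measurable functions. *)
Lemma measurable_funV_gt0 (f : T -> R) : (forall x, 0 < f x) ->
  measurable_fun setT f -> measurable_fun setT (fun x => (f x)^-1).
Proof.
move=> f0 mf; rewrite (_ : (fun x => _) = fun x => expR (- ln (f x))).
  by apply: measurableT_comp => //; apply: measurable_funN; exact: measurableT_comp.
by apply/funext => x; rewrite expRN lnK// posrE.
Qed.

(** The inverse is the adjugate divided by the determinant, and cofactors are again determinants. *)
Lemma measurable_invmx p (f : T -> 'M[R]_p) : (forall x, spd (f x)) ->
  measurable_mx f -> measurable_mx (fun x => invmx (f x)).
Proof.
move=> sf mf; under eq_fun do rewrite /invmx spd_unit//.
apply: measurable_mxZ.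
  apply: measurable_funV_gt0; last exact: measurable_det.
  by move=> x; exact: spd_det_gt0.
move=> i j; under eq_fun do rewrite mxE /cofactor.
apply: measurable_funM => //; apply: measurable_det => k l.
under eq_fun do rewrite !mxE; exact: mf.
Qed.

Lemma measurable_qform p (f : T -> 'M[R]_p) (g : T -> 'cV[R]_p) :
  measurable_mx f -> measurable_mx g ->
  measurable_fun setT (fun x => qform (f x) (g x)).
Proof.
move=> mf mg.
exact: (measurable_mxM (measurable_mxM (measurable_mx_tr mg) mf) mg 0 0).
Qed.

Lemma measurable_mx_comp d' (T' : measurableType d') (h : T' -> T) p q
    (f : T -> 'M[R]_(p, q)) :
  measurable_fun setT h -> measurable_mx f -> measurable_mx (fun x => f (h x)).
Proof.
by move=> mh mf i j; exact: (@measurableT_comp _ _ _ _ _ _ (fun x => f x i j)).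
Qed.

End MeasurableMx.

(** * Gaussian integrals in one variable *)

Section Gauss.
Context {R : realType}.

(* Up to the factor (2 pi)^(n/2), [gauss A b] is the integral over v of [quadexp A b v]. *)
Definition quadexp n (A : 'M[R]_n) (b v : 'cV[R]_n) : R :=
  expR ((v^T *m b) 0 0 - 2^-1 * qform A v).

Definition gauss n (A : 'M[R]_n) (b : 'cV[R]_n) : R :=
  expR (2^-1 * (qform (invmx A) b - ln (\det A))).

(** The integrand is the normal density of mean [mu] and variance [a^-1] divided by its peak value,
    so the integral is the inverse of the peak. The value is written with exponentials of logarithms
    to match [gauss]. *)
Lemma integral_gauss1 (a mu : R) : 0 < a ->
  (\int[lebesgue_measure]_x (expR (- (2^-1 * a * (x - mu) ^+ 2)))%:E
   = (expR (2^-1 * ln (2 * pi)) * expR (- (2^-1 * ln a)))%:E)%E.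
Proof.
move=> a0; pose s := Num.sqrt a^-1.
have s2 : s ^+ 2 = a^-1 by rewrite sqr_sqrtr// invr_ge0 ltW.
have s0 : s != 0 by rewrite gt_eqF// sqrtr_gt0 invr_gt0.
have pk : 0 < normal_peak s by exact: normal_peak_gt0.
have pi0 : 0 < pi :> R by exact: pi_gt0.
have npk : (normal_peak s)^-1 = expR (2^-1 * ln (2 * pi)) * expR (- (2^-1 * ln a)).
  rewrite /normal_peak invrK s2 -expRD.
  have -> : a^-1 * pi *+ 2 = (2 * pi) * a^-1 by ring.
  have q0 : 0 < 2 * pi * a^-1 :> R by rewrite divr_gt0// mulr_gt0.
  rewrite -[LHS]lnK ?posrE ?sqrtr_gt0//; congr expR.
  have e : ln (2 * pi * a^-1) = ln (Num.sqrt (2 * pi * a^-1)) *+ 2.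
    by rewrite -lnXn ?sqrtr_gt0// sqr_sqrtr// ltW.
  have : ln (2 * pi * a^-1) = ln (2 * pi) - ln a.
    by rewrite ln_div// posrE// mulr_gt0.
  by rewrite e mulr2n => h; lra.
rewrite -npk -[RHS]mule1 -(integral_normal_pdf mu s) -ge0_integralZl_EFin//=; last 3 first.
- by move=> x _; rewrite lee_fin normal_pdf_ge0.
- by apply/measurable_EFinP; exact: measurable_normal_pdf.
- by rewrite invr_ge0 ltW.
apply: eq_integral => x _; rewrite normal_pdfE// -EFinM mulKf ?gt_eqF//.
rewrite /normal_fun s2; congr (expR _)%:E; field; exact: lt0r_neq0.
Qed.

End Gauss.

(** * Integrating out the direction, coordinate by coordinate *)

Section GaussianMixture.
Context d (Om : measurableType d) (R : realType) (P : probability Om R).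

(** What Tonelli's theorem and the elimination of a coordinate require of the integrand. The weight
    [K] collects the factors produced by the coordinates already integrated. *)
Record mixable n (K : Om -> R) (A : Om -> 'M[R]_n) (b : Om -> 'cV[R]_n) : Prop := {
  mixable_ge0 : forall om, 0 <= K om ;
  mixable_meas : measurable_fun setT K ;
  mixable_measA : measurable_mx A ;
  mixable_measb : measurable_mx b ;
  mixable_spd : forall om, spd (A om) }.

Lemma measurable_quadexp d' (T : measurableType d') n (A : T -> 'M[R]_n)
    (b v : T -> 'cV[R]_n) :
  measurable_mx A -> measurable_mx b -> measurable_mx v ->
  measurable_fun setT (fun x => quadexp (A x) (b x) (v x)).
Proof.
move=> mA mb mv; apply: measurableT_comp => //; apply: measurable_funB.
  exact: (measurable_mxM (measurable_mx_tr mv) mb 0 0).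
by apply: measurable_funM => //; exact: measurable_qform.
Qed.

(** The new factor is the integral over the first coordinate without its constant [sqrt (2 pi)]: it
    equals [a^(-1/2) exp(b0^2 / (2 a))], where [b0] is the first entry of [b]. *)
Definition schur_weight n (K : Om -> R) (A : Om -> 'M[R]_(1 + n))
    (b : Om -> 'cV[R]_(1 + n)) (om : Om) : R :=
  let a := ulsubmx (A om) 0 0 in
  K om * expR (2^-1 * (a^-1 * usubmx (b om) 0 0 ^+ 2 - ln a)).

Lemma mixable_schur n (K : Om -> R) (A : Om -> 'M[R]_(1 + n))
    (b : Om -> 'cV[R]_(1 + n)) :
  mixable K A b ->
  mixable (schur_weight K A b) (fun om => schur (A om))
    (fun om => schur_vec (A om) (b om)).
Proof.
move=> [K0 mK mA mb sA].
have ma : measurable_fun setT (fun om => ulsubmx (A om) 0 0).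
  by under eq_fun do rewrite !mxE; exact: mA.
have mV : measurable_fun setT (fun om => (ulsubmx (A om) 0 0)^-1).
  by apply: measurable_funV_gt0 => // om; exact: spd_ul_gt0.
have mu : measurable_mx (fun om => dlsubmx (A om)).
  by move=> i j; under eq_fun do rewrite !mxE; exact: mA.
have mb0 : measurable_fun setT (fun om => usubmx (b om) 0 0).
  by under eq_fun do rewrite !mxE; exact: mb.
split.
- by move=> om; rewrite mulr_ge0// expR_ge0.
- apply: measurable_funM => //; apply: measurableT_comp => //.
  apply: measurable_funM => //; apply: measurable_funB; last exact: measurableT_comp.
  by apply: measurable_funM => //; exact: measurable_funX.
- apply: measurable_mxB.
    by move=> i j; under eq_fun do rewrite !mxE; exact: mA.
  by apply: measurable_mxZ => //; apply: measurable_mxM => //; exact: measurable_mx_tr.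
- apply: measurable_mxB.
    by move=> i j; under eq_fun do rewrite !mxE; exact: mb.
  by apply: measurable_mxZ => //; exact: measurable_funM.
- by move=> om; exact: spd_schur.
Qed.

Lemma measurable_mix_slice n (K : Om -> R) (A : Om -> 'M[R]_(1 + n))
    (b : Om -> 'cV[R]_(1 + n)) (v : 'cV[R]_n) :
  mixable K A b ->
  measurable_fun setT (fun p : R * Om =>
    (K p.2 * quadexp (A p.2) (b p.2) (col_mx p.1%:M v))%:E).
Proof.
move=> [K0 mK mA mb sA]; apply/measurable_EFinP; apply: measurable_funM.
  exact: (measurableT_comp mK).
apply: measurable_quadexp.
- exact: (measurable_mx_comp (h := snd)).
- exact: (measurable_mx_comp (h := snd)).
- move=> i j; rewrite -[i]splitK; case: (fintype.split i) => k /=.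
    under eq_fun do rewrite col_mxEu mxE.
    by case: (k == j); [exact: measurable_fst|exact: (measurable_cst (0 : R))].
  by under eq_fun do rewrite col_mxEd; exact: measurable_cst.
Qed.

Lemma gauss_schur n (K : Om -> R) (A : Om -> 'M[R]_(1 + n))
    (b : Om -> 'cV[R]_(1 + n)) (om : Om) : spd (A om) ->
  K om * gauss (A om) (b om) =
  schur_weight K A b om * gauss (schur (A om)) (schur_vec (A om) (b om)).
Proof.
move=> sA; rewrite /schur_weight /gauss -mulrA -expRD; congr (_ * expR _).
rewrite qform_inv_schur// det_schur// lnM ?posrE ?spd_ul_gt0//; first by ring.
exact/spd_det_gt0/spd_schur.
Qed.

(** Tonelli exchanges the two integrals; for fixed [om], completing the square leaves a
    one-dimensional Gaussian in [x]. *)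
Lemma integral_mix_slice n (K : Om -> R) (A : Om -> 'M[R]_(1 + n))
    (b : Om -> 'cV[R]_(1 + n)) (v : 'cV[R]_n) :
  mixable K A b ->
  (\int[lebesgue_measure]_x \int[P]_om
     (K om * quadexp (A om) (b om) (col_mx x%:M v))%:E =
  (expR (2^-1 * ln (2 * pi)))%:E *
   \int[P]_om (schur_weight K A b om *
       quadexp (schur (A om)) (schur_vec (A om) (b om)) v)%:E)%E.
Proof.
move=> mix; have [K0 mK mA mb sA] := mix.
have mix' := mixable_schur mix; have [K0' mK' mA' mb' sA'] := mix'.
have mf := measurable_mix_slice v mix.
rewrite (@fubini_tonelli _ _ _ _ _ (lebesgue_measure) P
  (fun p : R * Om => (K p.2 * quadexp (A p.2) (b p.2) (col_mx p.1%:M v))%:E))//; last first.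
  by move=> p; rewrite lee_fin mulr_ge0// expR_ge0.
rewrite -ge0_integralZl_EFin//=; last 2 first.
- by move=> om _; rewrite lee_fin mulr_ge0// expR_ge0.
- apply/measurable_EFinP; apply: measurable_funM => //; apply: (measurable_quadexp (v := fun=> v)) => //.
apply: eq_integral => om _ /=; rewrite /fubini_G /=.
pose a := ulsubmx (A om) 0 0.
pose mu := a^-1 * (usubmx (b om) 0 0 - (v^T *m dlsubmx (A om)) 0 0).
(* [r] gathers everything that does not depend on [x]. *)
pose r := K om * (expR (2^-1 * (a^-1 * usubmx (b om) 0 0 ^+ 2)) *
  quadexp (schur (A om)) (schur_vec (A om) (b om)) v).
under eq_integral => x _.
  rewrite /quadexp complete_square//= -/a -/mu expRD expRD -/(quadexp _ _ _) mulrA -/r EFinM.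
  over.
have r0 : 0 <= r by rewrite !mulr_ge0// expR_ge0.
rewrite ge0_integralZl_EFin//=; last first.
  apply/measurable_EFinP/measurableT_comp => //; apply: measurable_funN.
  apply: measurable_funM => //; apply: measurable_funX; exact: measurable_funB.
rewrite integral_gauss1 ?spd_ul_gt0// -!EFinM; congr (_%:E).
by rewrite /r /schur_weight -/a mulrBr expRD -mulrN; ring.
Qed.

(* The hypothesis is integrated in [v] against Lebesgue measure, one coordinate at a time. *)
Lemma gaussian_mixture_le n (K1 K2 : Om -> R) (A1 A2 : Om -> 'M[R]_n)
    (b1 b2 : Om -> 'cV[R]_n) :
  mixable K1 A1 b1 -> mixable K2 A2 b2 ->
  (forall v, (\int[P]_om (K1 om * quadexp (A1 om) (b1 om) v)%:E <=
              \int[P]_om (K2 om * quadexp (A2 om) (b2 om) v)%:E)%E) ->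
  (\int[P]_om (K1 om * gauss (A1 om) (b1 om))%:E <=
   \int[P]_om (K2 om * gauss (A2 om) (b2 om))%:E)%E.
Proof.
elim: n K1 K2 A1 A2 b1 b2 => [|n IH] K1 K2 A1 A2 b1 b2 mix1 mix2 le12.
  (* In dimension 0 there is nothing to integrate: both functions equal 1, and the hypothesis at
     [v = 0] is the claim. *)
  have e0 (A : 'M[R]_0) (b : 'cV[R]_0) : gauss A b = quadexp A b 0.
    rewrite /gauss /quadexp /qform det_mx00 ln1 trmx0 !mul0mx subr0.
    by rewrite [b]flatmx0 mulmx0 !mxE mulr0 subr0.
  by under eq_integral do rewrite e0; under [leRHS]eq_integral do rewrite e0.
have e (K : Om -> R) (A : Om -> 'M[R]_(1 + n)) (b : Om -> 'cV[R]_(1 + n)) :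
    mixable K A b ->
    (\int[P]_om (K om * gauss (A om) (b om))%:E = \int[P]_om (schur_weight K A b om *
      gauss (schur (A om)) (schur_vec (A om) (b om)))%:E)%E.
  move=> mix; apply: eq_integral => om _; congr (_%:E).
  exact/gauss_schur/(mixable_spd mix).
rewrite (e _ _ _ mix1) (e _ _ _ mix2); apply: IH; [exact: mixable_schur|exact: mixable_schur|move=> v].
have ge0 (K : Om -> R) (A : Om -> 'M[R]_(1 + n)) (b : Om -> 'cV[R]_(1 + n)) :
    mixable K A b -> forall x : R, (0 <= \int[P]_om
     (K om * quadexp (A om) (b om) (col_mx x%:M v))%:E)%E.
  move=> mix x; apply: integral_ge0 => om _.
  by rewrite lee_fin mulr_ge0 ?expR_ge0// (mixable_ge0 mix).
have meas (K : Om -> R) (A : Om -> 'M[R]_(1 + n)) (b : Om -> 'cV[R]_(1 + n)) :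
    mixable K A b -> measurable_fun setT (fun x : R => (\int[P]_om
     (K om * quadexp (A om) (b om) (col_mx x%:M v))%:E)%E).
  move=> mix; apply: (measurable_fun_fubini_tonelli_F (m2 := P)
    (fun p : R * Om => (K p.2 * quadexp (A p.2) (b p.2) (col_mx p.1%:M v))%:E)).
    exact: measurable_mix_slice.
  by move=> p; rewrite lee_fin mulr_ge0 ?expR_ge0// (mixable_ge0 mix).
(* Integrating the hypothesis over the first coordinate gives the inequality for the Schur data, up
   to the positive constant [sqrt (2 pi)] common to both sides. *)
have := integral_mix_slice v mix1; have := integral_mix_slice v mix2.
set J1 := (X in _ -> X = _ -> _); set J2 := (X in X = _ -> _) => e2 e1.
have J12 : (J1 <= J2)%E.
  by apply: ge0_le_integral => //; [move=> x _; exact: ge0|exact: meas|exact: meas].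
move: J12; rewrite e1 e2 lee_pmul2l//.
by rewrite lte_fin expR_gt0.
Qed.

End GaussianMixture.

(** * Rounding to a grid, entrywise limits of matrices, and a form of Fatou's lemma *)

Section Rounding.
Context {R : realType}.

(** Takes the integer index of the grid point, not the real number to be rounded, so that it can be
    applied to an index decoded from a natural number. *)
Definition round_down (k : nat) (z : int) : R := z%:~R / k.+1%:R.

Lemma round_down_cvg (x : R) : round_down k (Num.floor (x * k.+1%:R)) @[k --> \oo] --> x.
Proof.
apply: (@squeeze_cvgr _ _ _ _ (fun k => x - k.+1%:R^-1) (fun=> x)).
- apply: nearW => k; have k0 : 0 < k.+1%:R :> R by rewrite ltr0n.
  have /andP[lo hi] := floor_itv (x * k.+1%:R).
  rewrite /round_down ler_pdivrMr// lo andbT ler_pdivlMr// mulrBl mulVf ?gt_eqF//.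
  by rewrite lerBlDr ltW// (lt_le_trans hi)// intrD.
- rewrite -[X in _ --> X]subr0; apply: cvgB; first exact: cvg_cst.
  exact: cvg_harmonic.
- exact: cvg_cst.
Qed.

Lemma round_down_le (x : R) k : round_down k (Num.floor (x * k.+1%:R)) <= x.
Proof.
have k0 : 0 < k.+1%:R :> R by rewrite ltr0n.
by have /andP[lo _] := floor_itv (x * k.+1%:R); rewrite /round_down ler_pdivrMr.
Qed.

Lemma cvg_mulmx p q r (f : nat -> 'M[R]_(p, q)) (g : nat -> 'M[R]_(q, r))
    (F : 'M[R]_(p, q)) (G : 'M[R]_(q, r)) :
  (forall i j, f k i j @[k --> \oo] --> F i j) ->
  (forall i j, g k i j @[k --> \oo] --> G i j) ->
  forall i j, (f k *m g k) i j @[k --> \oo] --> (F *m G) i j.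
Proof.
move=> fF gG i j; rewrite mxE; under eq_fun do rewrite mxE.
by apply: cvg_big => [|l _]; [exact: add_continuous|exact: cvgM].
Qed.

Lemma cvg_trmx p q (f : nat -> 'M[R]_(p, q)) (F : 'M[R]_(p, q)) :
  (forall i j, f k i j @[k --> \oo] --> F i j) ->
  forall i j, (f k)^T i j @[k --> \oo] --> F^T i j.
Proof. by move=> fF i j; rewrite mxE; under eq_fun do rewrite mxE; exact: fF. Qed.

End Rounding.

Lemma fatou_le d (T : measurableType d) (R : realType) (mu : {measure set T -> \bar R})
    (D : set T) (f : nat -> T -> R) (g : T -> R) (c : \bar R) :
  measurable D -> (forall k, measurable_fun D (f k)) ->
  (forall k x, 0 <= f k x) -> (forall x, f k x @[k --> \oo] --> g x) ->
  (forall k, \int[mu]_(x in D) (f k x)%:E <= c)%E ->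
  (\int[mu]_(x in D) (g x)%:E <= c)%E.
Proof.
move=> mD mf f0 fg fc.
have -> : (\int[mu]_(x in D) (g x)%:E =
    \int[mu]_(x in D) limn_einf (fun k => (f k x)%:E))%E.
  apply: eq_integral => x _.
  suff /cvg_limn_einf_sup[-> _] : (f k x)%:E @[k --> \oo] --> (g x)%:E by [].
  by apply: cvg_EFin; [exact: nearW|exact: fg].
apply: le_trans (fatou mu mD _ _) _.
- by move=> k; apply/measurable_EFinP.
- by move=> k x _; rewrite lee_fin.
(* The infimum over each tail is at most its first term, which is at most [c]. *)
- rewrite limn_einf_lim; apply: lime_le; first exact: is_cvg_einfs.
  apply: nearW => k; apply: le_trans (fc k).
  by apply: ereal_inf_lbound; exists k => /=.
Qed.

(** * The sub-Gaussian bound for random directions measurable in the conditioning sigma-algebra *)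

Section Freezing.
Context d (Om : measurableType d) (R : realType) (P : probability Om R).
Variables (G : set (set Om)) (m : nat) (w : Om -> 'cV[R]_m) (q : 'cV[R]_m -> R).
(** The same points as [Om] with the sigma-algebra generated by [G]: measurability on [OmG]
    expresses being known given [G]. *)
Let OmG : measurableType (sigma_display G) := g_sigma_algebraType G.
Hypothesis subG : forall A : set OmG, measurable A -> d.-measurable (A : set Om).
Hypothesis mw : measurable_mx w.
Hypothesis subgauss : forall nu (A : set OmG), measurable A ->
  (\int[P]_(om in A) (expR ((nu^T *m w om) 0 0))%:E <= (expR (q nu))%:E * P A)%E.

Lemma measurable_fun_sub d' (U : measurableType d') (f : OmG -> U) :
  measurable_fun setT f -> measurable_fun setT (f : Om -> U).
Proof. by move=> mf _ Y mY; apply: subG; exact: mf. Qed.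

Lemma measurable_fun_code d' (U : measurableType d') (c : OmG -> nat) (f : nat -> U) :
  (forall i, measurable [set om | c om = i]) ->
  measurable_fun setT (fun om : OmG => f (c om)).
Proof.
move=> mc _ Y mY; rewrite setTI.
rewrite (_ : _ @^-1` _ = \bigcup_(i in [set i | Y (f i)]) [set om | c om = i]).
  by apply: bigcup_measurable => i _; exact: mc.
by apply/seteqP; split => [om Yf|om [i Yi /= ci]]; [exists (c om)|rewrite /= ci].
Qed.

(** On each level set of [c] the direction is constant, so the hypothesis applies there; the level
    sets are countably many and the integrals add up. *)
Lemma freeze_countable (c : OmG -> nat) (l : nat -> R) (nu : nat -> 'cV[R]_m)
    (E : set OmG) :
  (forall i, measurable [set om | c om = i]) -> measurable E ->
  (\int[P]_(om in E)
     (expR (l (c om) + (((nu (c om))^T *m w om) 0 0 - q (nu (c om)))))%:E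
   <= \int[P]_(om in E) (expR (l (c om)))%:E)%E.
Proof.
move=> mc mE; pose F i := E `&` [set om | c om = i].
have mFG i : measurable (F i : set OmG) by apply: measurableI => //; exact: mc.
have mF i : d.-measurable (F i : set Om) by exact: subG.
have EF : E = \bigcup_i F i.
  by apply/seteqP; split => [om Eom|om [i _ []//]]; exists (c om).
have tF : trivIset setT F.
  by move=> i j _ _ [om [[_ /= ci] [_ /= cj]]]; rewrite -ci -cj.
have mcode d' (U : measurableType d') (f : nat -> U) :
    measurable_fun setT (fun om : Om => f (c om)).
  by apply: measurable_fun_sub; exact: measurable_fun_code.
have ml : measurable_fun setT (fun om : Om => expR (l (c om))).
  exact: (mcode _ _ (fun i => expR (l i))).
have mX : measurable_fun setT (fun om : Om =>
    expR (l (c om) + (((nu (c om))^T *m w om) 0 0 - q (nu (c om))))).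
  apply: measurableT_comp => //; apply: measurable_funD; first exact: mcode.
  apply: measurable_funB; last exact: (mcode _ _ (fun i => q (nu i))).
  have mnu : measurable_mx (fun om : Om => (nu (c om))^T).
    by move=> i j; exact: (mcode _ _ (fun k => (nu k)^T i j)).
  exact: (measurable_mxM mnu mw 0 0).
rewrite EF !ge0_integral_bigcup//=; last 2 first.
- by apply/measurable_EFinP; exact: measurable_funTS.
- by apply/measurable_EFinP; exact: measurable_funTS.
apply: lee_nneseries => [i _ _|i _].
  by apply: integral_ge0 => om _; rewrite lee_fin expR_ge0.
have e1 : (\int[P]_(om in F i) (expR (l (c om)))%:E = (expR (l i))%:E * P (F i))%E.
  rewrite -(integral_cst P (mF i)); apply: eq_integral => om.
  by rewrite inE => -[_ /= ->].
rewrite e1 (_ : (\int[P]_(om in F i) _ =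
    (expR (l i - q (nu i)))%:E * \int[P]_(om in F i) (expR (((nu i)^T *m w om) 0 0))%:E)%E).
  (* The hypothesis contributes [expR (q (nu i))], which cancels the [- q (nu i)] in the constant
     factor. *)
  apply: (@le_trans _ _
      ((expR (l i - q (nu i)))%:E * ((expR (q (nu i)))%:E * P (F i)))%E).
    by apply: lee_wpmul2l; [rewrite lee_fin expR_ge0|exact: subgauss].
  by rewrite muleA -EFinM -expRD subrK.
rewrite -ge0_integralZl_EFin//; last first.
  apply/measurable_EFinP/measurable_funTS/measurableT_comp => //.
  exact: (measurable_mxM (@measurable_mx_cst _ Om _ _ _ (nu i)^T) mw 0 0).
apply: eq_integral => om; rewrite inE => -[_ /= ->].
by rewrite -EFinM -expRD; congr (expR _)%:E; ring.
Qed.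

Hypothesis cvg_q : forall (nu : nat -> 'cV[R]_m) (nu0 : 'cV[R]_m),
  (forall i j, nu k i j @[k --> \oo] --> nu0 i j) -> q (nu k) @[k --> \oo] --> q nu0.

(* Round [l] and [nu] down to the grid of mesh [1/(k+1)], where they take countably
   many values, and pass to the limit by Fatou's lemma. *)
Lemma freeze (l : OmG -> R) (nu : OmG -> 'cV[R]_m) (E : set OmG) :
  measurable_fun setT l -> measurable_mx nu -> measurable E ->
  (\int[P]_(om in E) (expR (l om + (((nu om)^T *m w om) 0 0 - q (nu om))))%:E
   <= \int[P]_(om in E) (expR (l om))%:E)%E.
Proof.
move=> ml mnu mE.
pose gridpt k om : int * 'cV[int]_m := (Num.floor (l om * k.+1%:R),
  \col_i Num.floor (nu om i 0 * k.+1%:R)).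
pose c k om := pickle (gridpt k om).
(* The default [(0, 0)] is never met on the codes [c k om], as [decK] shows. *)
pose dec i : int * 'cV[int]_m := odflt (0, 0) (unpickle i).
have decK k om : dec (c k om) = gridpt k om by rewrite /dec /c pickleK.
pose lk k i : R := round_down k (dec i).1.
pose nuk k i : 'cV[R]_m := \col_j round_down k ((dec i).2 j 0).
have mfloor k (f : OmG -> R) (z : int) : measurable_fun setT f ->
    measurable [set om | Num.floor (f om * k.+1%:R) = z].
  move=> mf.
  have mfk : measurable_fun setT (fun om => f om * k.+1%:R) by exact: measurable_funM.
  have := mfk measurableT `[z%:~R, (z + 1)%:~R[%classic (measurable_itv _).
  rewrite setTI; congr (measurable _); apply/seteqP; split => om /=.
    by rewrite in_itv/= -floor_eq => /eqP.
  by move=> <-; rewrite in_itv/= floor_itv.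
have mc k i : measurable [set om | c k om = i].
  (* A nonempty level set of the code is a finite intersection of level sets of floors, whose values
     are read off at a point [om0] of it. *)
  have [[om0 com0]|nc] := pselect (exists om, c k om = i); last first.
    rewrite (_ : mkset _ = set0)//.
    by apply/seteqP; split => om //= e; apply: nc; exists om.
  rewrite (_ : mkset _ = [set om | Num.floor (l om * k.+1%:R) = (gridpt k om0).1] `&`
    \bigcap_(j in [set: 'I_m])
      [set om | Num.floor (nu om j 0 * k.+1%:R) = (gridpt k om0).2 j 0]).
    apply: measurableI; first exact: mfloor.
    apply: fin_bigcap_measurable => // j _; apply: mfloor; exact: mnu.
  apply/seteqP; split => om /=.
    rewrite -com0 => /(pcan_inj pickleK) e; split; first by have := congr1 fst e.
    by move=> j _; have := congr1 (fun p : int * 'cV[int]_m => p.2 j 0) e; rewrite /= !mxE.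
  move=> [e1 e2]; rewrite -com0 /c; congr pickle.
  rewrite /gridpt e1; congr pair; apply/matrixP => j o.
  by have := e2 j I; rewrite /= !mxE.
have mE' : d.-measurable (E : set Om) by exact: subG.
have mlk k : measurable_fun setT (fun om : Om => lk k (c k om)).
  by apply: measurable_fun_sub; exact: (measurable_fun_code (lk k) (mc k)).
have mnuk k : measurable_mx (fun om : Om => nuk k (c k om)).
  move=> i j; apply: measurable_fun_sub.
  exact: (measurable_fun_code (fun z => nuk k z i j) (mc k)).
have cvgl om : lk k (c k om) @[k --> \oo] --> l om.
  by rewrite /lk; under eq_fun do rewrite decK; exact: round_down_cvg.
have cvgnu om i j : nuk k (c k om) i j @[k --> \oo] --> nu om i j.
  rewrite /nuk; under eq_fun do rewrite mxE decK /= mxE.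
  by rewrite [j]ord1; exact: round_down_cvg.
apply: (@fatou_le _ Om _ P _ (fun k (om : Om) => expR (lk k (c k om) +
  (((nuk k (c k om))^T *m w om) 0 0 - q (nuk k (c k om)))))) => //.
- move=> k; apply/measurable_funTS/measurableT_comp => //.
  apply: measurable_funD => //; apply: measurable_funB.
    exact: (measurable_mxM (measurable_mx_tr (mnuk k)) mw 0 0).
  by apply: measurable_fun_sub; exact: (measurable_fun_code (fun i => q (nuk k i)) (mc k)).
- move=> om; apply: continuous_cvg; first exact: continuous_expR.
  apply: cvgD => //; apply: cvgB; last by apply: cvg_q => i j; exact: cvgnu.
  apply: cvg_mulmx => [i j|i j]; last exact: cvg_cst.
  by apply: cvg_trmx => *; exact: cvgnu.
(* Since [l] is rounded downwards, the right-hand side for the grid is at most the one for [l] at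
   every [k]. *)
- move=> k; apply: le_trans (freeze_countable (lk k) (nuk k) (mc k) mE) _.
  apply: ge0_le_integral => //.
  + by apply/measurable_EFinP/measurable_funTS/measurableT_comp.
  + by apply/measurable_EFinP/measurable_funTS/measurableT_comp => //; exact: measurable_fun_sub.
  + move=> om _; rewrite lee_fin ler_expR /lk decK; exact: round_down_le.
Qed.

End Freezing.

(** * Ville's maximal inequality for nonnegative supermartingales *)

Lemma measurable_gt d (T : measurableType d) (R : realType) (a : R) (f : T -> R) :
  measurable_fun setT f -> measurable [set x | a < f x].
Proof.
move=> mf; have := mf measurableT `]a, +oo[%classic (measurable_itv _).
by rewrite setTI; congr (measurable _); apply/seteqP; split => x /=; rewrite in_itv/= andbT.
Qed.

Section Ville.
Context d (Om : measurableType d) (R : realType) (P : probability Om R).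
Variables (T : option nat) (G : nat -> set (set Om)) (Z : nat -> Om -> R) (a : R).
Let OmG t : measurableType (sigma_display (G t)) := g_sigma_algebraType (G t).
Hypothesis Z0 : forall t om, 0 <= Z t om.
Hypothesis mZ : forall t, leT T t -> measurable_fun setT (Z t).
Hypothesis adaptedZ : forall s t, leT1 T t -> (s <= t)%N ->
  measurable_fun setT (Z s : OmG t -> R).
Hypothesis superZ : forall t (A : set (OmG t)), leT1 T t -> measurable A ->
  (\int[P]_(om in A) (Z t.+1 om)%:E <= \int[P]_(om in A) (Z t om)%:E)%E.
Hypothesis a0 : 0 <= a.

(** The strict [s < t] makes [crossed t.+1] an event decided by [Z 0, ..., Z t], hence one on whose
    complement the supermartingale inequality at time [t] may be used. *)
Let crossed t : set Om := [set om | exists2 s, (s < t)%N & a < Z s om].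

Let crossedS t : crossed t.+1 = crossed t `|` [set om | a < Z t om].
Proof.
apply/seteqP; split => om /=.
  by case=> s; rewrite ltnS leq_eqVlt => /orP[/eqP->|st] aZ; [right|left; exists s].
by case=> [[s st aZ]|aZ]; [exists s => //; exact: ltnW|exists t].
Qed.

Let crossed0 : crossed 0 = set0.
Proof. by apply/seteqP; split => om //= -[]. Qed.

Let leT_S t : leT T t.+1 -> leT1 T t /\ leT T t.
Proof. by case: T => //= T' tT; split => //; exact: ltnW. Qed.

Let leT_le s t : (s <= t)%N -> leT T t -> leT T s.
Proof. by case: T => //= T' st; exact: leq_trans. Qed.

Let measurable_above t : leT T t -> measurable [set om | a < Z t om].
Proof. by move=> tT; apply: measurable_gt; exact: mZ. Qed.

Let measurable_crossed t : (forall s, (s < t)%N -> leT T s) -> measurable (crossed t).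
Proof.
elim: t => [|t IH] tT; first by rewrite crossed0; exact: measurable0.
rewrite crossedS; apply: measurableU; last by apply: measurable_above; exact: tT.
by apply: IH => s st; apply: tT; exact: ltnW.
Qed.

Let adapted_crossed t : leT1 T t -> measurable (crossed t.+1 : set (OmG t)).
Proof.
move=> tT; suff : forall s, (s <= t.+1)%N -> measurable (crossed s : set (OmG t)).
  exact.
elim=> [|s IH] st; first by rewrite crossed0; exact: measurable0.
rewrite crossedS; apply: measurableU; first by apply: IH; exact: ltnW.
by apply: measurable_gt; exact: adaptedZ.
Qed.

(** On the paths that cross for the first time at [t], [Z t] exceeds [a]; moving them from the
    integral to the probability term can only lower the sum. *)
Let crossing_step t : leT T t ->
  (a%:E * P (crossed t.+1) + \int[P]_(om in ~` crossed t.+1) (Z t om)%:E <=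
   a%:E * P (crossed t) + \int[P]_(om in ~` crossed t) (Z t om)%:E)%E.
Proof.
move=> tT; pose A := ~` crossed t `&` [set om | a < Z t om].
have mC : measurable (crossed t) by apply: measurable_crossed => s /ltnW st; exact: leT_le tT.
have mA : measurable A.
  by apply: measurableI; [exact: measurableC|exact: measurable_above].
have CS : crossed t.+1 = crossed t `|` A.
  rewrite crossedS /A; apply/seteqP; split => om /=.
    by case=> [|aZ]; [left|have [|] := pselect (crossed t om); [left|right]].
  by case=> [|[]]; [left|right].
have mCS : measurable (crossed t.+1) by rewrite CS; exact: measurableU.
have CC : ~` crossed t = A `|` ~` crossed t.+1.
  rewrite CS setCU; apply/seteqP; split => om /=.
    by move=> Ct; have [|] := pselect (A om); [left|right].
  by case=> -[].
have mZt D : measurable_fun D (fun om => (Z t om)%:E).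
  by apply/measurable_EFinP/measurable_funTS/mZ.
have dis : [disjoint A & ~` crossed t.+1].
  by apply/disj_setPS => om [Aom]; rewrite CS => /= -[]; right.
rewrite [in leRHS]CC (ge0_integral_setU P mA (measurableC mCS) (mZt _) _ dis)//; last first.
  by move=> om _; rewrite lee_fin.
rewrite {1}CS measureU//; last first.
  by apply/seteqP; split => om // -[? []].
rewrite ge0_muleDr// -[leLHS]addeA; apply: leeD2l; apply: leeD2r.
rewrite -(integral_cst P mA); apply: ge0_le_integral => //.
by move=> om [_ /= aZ]; rewrite lee_fin ltW.
Qed.

(** The left-hand side is the mean of the process replaced by [a] once it has crossed. It does not
    increase: [superZ] advances [Z] off [crossed t.+1], then [crossing_step] accounts for crossings
    at [t]. *)
Let crossing_bound t : leT T t ->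
  (a%:E * P (crossed t) + \int[P]_(om in ~` crossed t) (Z t om)%:E
   <= \int[P]_om (Z 0 om)%:E)%E.
Proof.
elim: t => [|t IH] tT; first by rewrite crossed0 measure0 mule0 add0e setC0.
have [tT1 tT0] := leT_S tT.
apply: le_trans (IH tT0); apply: le_trans (crossing_step tT0).
by apply: leeD2l; apply: superZ => //; apply: measurableC; exact: adapted_crossed.
Qed.

Let crossing_prob t : leT T t ->
  (a%:E * P (crossed t.+1) <= \int[P]_om (Z 0 om)%:E)%E.
Proof.
move=> tT; apply: le_trans (crossing_bound tT); apply: le_trans (crossing_step tT).
by apply: leeDl; apply: integral_ge0 => om _; rewrite lee_fin.
Qed.

Lemma ville_measurable : measurable [set om | exists2 t, leT T t & a < Z t om].
Proof.
rewrite (_ : mkset _ = \bigcup_(t in [set t | leT T t]) [set om | a < Z t om]).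
  by apply: bigcup_measurable => t; exact: measurable_above.
by apply/seteqP; split => om [t]; exists t.
Qed.

Lemma ville : (a%:E * P [set om | exists2 t, leT T t & (a < Z t om)%R]
  <= \int[P]_om (Z 0 om)%:E)%E.
Proof.
have := crossing_prob; have := measurable_crossed; have := ville_measurable.
case: T => [T'|] /= mV mC cP.
  rewrite (_ : mkset _ = crossed T'.+1); first exact: cP.
  by apply/seteqP; split => om [t tT aZ]; exists t.
have e : [set om : Om | exists2 t : nat, true & a < Z t om] = \bigcup_t crossed t.
  apply/seteqP; split => om [t _].
    by move=> aZ; exists t.+1 => //; exists t.
  by move=> [s st aZ]; exists s.
(* For an infinite horizon the events [crossed t] increase to the event of ever crossing, so
   continuity from below applies. *)
have cv : (a%:E * P (crossed t))%E @[t --> \oo] --> (a%:E * P (\bigcup_t crossed t))%E.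
  apply: cvgeZl => //; apply: nondecreasing_cvg_mu.
  - by move=> t; exact: mC.
  - by rewrite -e.
  - move=> s t st; apply/subsetPset => om [r rs aZ]; exists r => //.
    exact: leq_trans st.
rewrite e -(cvg_lim _ cv)//; apply: lime_le; first by apply/cvg_ex; eexists; exact: cv.
apply: nearW => -[|t]; last exact: cP.
rewrite crossed0 measure0 mule0; apply: integral_ge0 => om _; by rewrite lee_fin.
Qed.

End Ville.

(** * Algebra of [Vt], [st] and quadratic forms *)

Section QuadraticForms.
Context {F : realFieldType}.

Lemma qformDl n (A B : 'M[F]_n) (v : 'cV[F]_n) :
  qform (A + B) v = qform A v + qform B v.
Proof. by rewrite /qform mulmxDr mulmxDl mxE. Qed.

Lemma qformZr n (A : 'M[F]_n) (k : F) (v : 'cV[F]_n) :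
  qform A (k *: v) = k ^+ 2 * qform A v.
Proof.
by rewrite /qform -scalemxAr [(k *: v)^T]linearZ /= -!scalemxAl scalerA mxE expr2.
Qed.

Lemma qform_congr m n (W : 'M[F]_m) (B : 'M[F]_(m, n)) (v : 'cV[F]_n) :
  qform (B^T *m W *m B) v = qform W (B *m v).
Proof. by rewrite /qform trmx_mul !mulmxA. Qed.

Lemma spd_ge0 n (A : 'M[F]_n) (v : 'cV[F]_n) : spd A -> 0 <= qform A v.
Proof.
move=> [_ Ap]; have [->|/Ap/ltW//] := eqVneq v 0.
by rewrite /qform mulmx0 mxE.
Qed.

Lemma VtS m n (W : 'M[F]_m) (Mt : nat -> 'M[F]_(m, n)) t :
  Vt W Mt t.+1 = Vt W Mt t + (Mt t)^T *m W *m Mt t.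
Proof. by rewrite /Vt big_ord_recr. Qed.

Lemma stS m n (W : 'M[F]_m) (Mt : nat -> 'M[F]_(m, n)) (wt : nat -> 'cV[F]_m) t :
  st W Mt wt t.+1 = st W Mt wt t + (Mt t)^T *m W *m wt t.
Proof. by rewrite /st big_ord_recr. Qed.

Lemma spd_addVt m n (W : 'M[F]_m) (A : 'M[F]_n) (Mt : nat -> 'M[F]_(m, n)) t :
  spd W -> spd A -> spd (A + Vt W Mt t).
Proof.
move=> sW sA; elim: t => [|t [Vs Vp]]; first by rewrite /Vt big_ord0 addr0.
rewrite VtS addrA; split.
  by rewrite linearD /= Vs !trmx_mul trmxK sW.1 mulmxA.
by move=> x x0; rewrite qformDl qform_congr ltr_wpDr ?Vp// spd_ge0.
Qed.

(** Relates the ratio of determinants that comes out of [gauss] to the determinant in the final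
    bound. *)
Lemma det_addVt n (A V : 'M[F]_n) : spd A ->
  \det (A + V) = \det A * \det (1%:M + invmx A *m V).
Proof. by move=> sA; rewrite -det_mulmx mulmxDr mulmx1 mulKVmx// spd_unit. Qed.

End QuadraticForms.

(** * One time step of the exponential process, and the mixture restricted to an event *)

Section GaussSteps.
Context {R : realType}.

(* The last summand is [nu^T w - cw^2/2 nu^T W^-1 nu] for [nu = W M v / cw], the direction
   in which the sub-Gaussian hypothesis is applied. *)
Lemma quadexp_step m n (W : 'M[R]_m) (A : 'M[R]_n) (B : 'M[R]_(m, n)) (s v : 'cV[R]_n)
    (w : 'cV[R]_m) (cw : R) : spd W -> cw != 0 ->
  let nu := cw^-1 *: (W *m B *m v) in
  quadexp (A + B^T *m W *m B) (cw^-1 *: (s + B^T *m W *m w)) v =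
  expR (((v^T *m (cw^-1 *: s)) 0 0 - 2^-1 * qform A v)
    + ((nu^T *m w) 0 0 - 2^-1 * cw ^+ 2 * qform (invmx W) nu)).
Proof.
move=> sW cw0 nu; congr expR.
have -> : nu^T *m w = cw^-1 *: (v^T *m B^T *m W *m w).
  by rewrite /nu [(_ *: _)^T]linearZ /= -scalemxAl !trmx_mul sW.1 !mulmxA.
have -> : qform (invmx W) nu = cw^-1 ^+ 2 * qform W (B *m v).
  rewrite /nu qformZr -[W *m B *m v]mulmxA.
  by rewrite (qform_inv sW erefl) /qform trmx_mul sW.1.
rewrite qformDl qform_congr -!scalemxAr mulmxDr !mulmxA.
set e1 := v^T *m s; set e2 := v^T *m _ *m _ *m w.
by rewrite !mxE; field.
Qed.

(** Take logarithms and multiply by [2 * cw ^+ 2]. The form of an equality lets the final event be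
    compared with the Ville event in both directions. *)
Lemma gauss_le n (A B : 'M[R]_n) (cw r : R) (b c : 'cV[R]_n) : 0 < cw -> 0 < r ->
  (gauss A (cw^-1 *: b) <= gauss B (cw^-1 *: c) / r) =
  (qform (invmx A) b <= qform (invmx B) c
     + cw ^+ 2 * (ln (\det A) - ln (\det B) + 2 * ln r^-1)).
Proof.
move=> cw0 r0; have r0' : 0 < r^-1 by rewrite invr_gt0.
rewrite /gauss -[in LHS](lnK (x := r^-1)) ?posrE// -expRD ler_expR !qformZr.
set x := qform _ b; set y := qform _ c.
rewrite -subr_ge0 -[in RHS]subr_ge0.
have -> : y + cw ^+ 2 * (ln (\det A) - ln (\det B) + 2 * ln r^-1) - x =
  2 * cw ^+ 2 * (2^-1 * (cw^-1 ^+ 2 * y - ln (\det B)) + ln r^-1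
   - 2^-1 * (cw^-1 ^+ 2 * x - ln (\det A))).
  by field; rewrite gt_eqF.
by rewrite pmulr_rge0// mulr_gt0// exprn_gt0.
Qed.

Lemma measurable_gauss d (T : measurableType d) n (A : T -> 'M[R]_n)
    (b : T -> 'cV[R]_n) :
  (forall x, spd (A x)) -> measurable_mx A -> measurable_mx b ->
  measurable_fun setT (fun x => gauss (A x) (b x)).
Proof.
move=> sA mA mb; apply: measurableT_comp => //; apply: measurable_funM => //.
apply: measurable_funB; first by apply: measurable_qform => //; exact: measurable_invmx.
by apply: measurableT_comp => //; exact: measurable_det.
Qed.

Lemma cvg_qform n (A : 'M[R]_n) (nu : nat -> 'cV[R]_n) (nu0 : 'cV[R]_n) :
  (forall i j, nu k i j @[k --> \oo] --> nu0 i j) ->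
  qform A (nu k) @[k --> \oo] --> qform A nu0.
Proof.
move=> cnu; rewrite /qform; apply: cvg_mulmx => // i j.
by apply: cvg_mulmx => *; [exact: cvg_trmx|exact: cvg_cst].
Qed.

End GaussSteps.

Lemma integral_indicM d (T : measurableType d) (R : realType)
    (mu : {measure set T -> \bar R}) (E : set T) (f : T -> R) :
  (\int[mu]_(x in E) (f x)%:E = \int[mu]_x (\1_E x * f x)%:E)%E.
Proof.
rewrite integral_mkcond; apply: eq_integral => x _.
by rewrite patchE indicE; case: (x \in E); rewrite ?mul1r ?mul0r.
Qed.

(** The restriction to [E] enters the mixture as the initial weight [\1_E]. *)
Lemma gaussian_mixture_le_in d (Om : measurableType d) (R : realType)
    (P : probability Om R) n (E : set Om) (A1 A2 : Om -> 'M[R]_n) (b1 b2 : Om -> 'cV[R]_n) :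
  measurable E -> measurable_mx A1 -> measurable_mx b1 -> measurable_mx A2 ->
  measurable_mx b2 -> (forall om, spd (A1 om)) -> (forall om, spd (A2 om)) ->
  (forall v, (\int[P]_(om in E) (quadexp (A1 om) (b1 om) v)%:E <=
              \int[P]_(om in E) (quadexp (A2 om) (b2 om) v)%:E)%E) ->
  (\int[P]_(om in E) (gauss (A1 om) (b1 om))%:E <=
   \int[P]_(om in E) (gauss (A2 om) (b2 om))%:E)%E.
Proof.
move=> mE mA1 mb1 mA2 mb2 sA1 sA2 le12; have e := integral_indicM P E.
rewrite (e (fun om => gauss (A1 om) (b1 om))) (e (fun om => gauss (A2 om) (b2 om))).
apply: gaussian_mixture_le.
- by split => //; exact: measurable_indic.
- by split => //; exact: measurable_indic.
- move=> v; have := le12 v.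
  by rewrite (e (fun om => quadexp (A1 om) (b1 om) v)) (e (fun om => quadexp (A2 om) (b2 om) v)).
Qed.

(** * The sigma-algebras of the observed data *)

Section Filtration.
Context d (Om : measurableType d) (R : realType) (m n : nat).
Variables (M : nat -> Om -> 'M[R]_(m, n)) (y : nat -> Om -> 'cV[R]_m).

Lemma sub_Dt t (A : set Om) :
  (forall k (i : 'I_m) (j : 'I_n), measurable_fun setT (fun om => M k om i j)) ->
  (forall k (i : 'I_m), measurable_fun setT (fun om => y k om i 0)) ->
  Dt M y t A -> measurable A.
Proof.
move=> mM my; apply: smallest_sub; first exact: sigma_algebra_measurable.
move=> B [[k [i [j [C [_ [mC ->]]]]]]|[k [i [C [_ [mC ->]]]]]].
  by rewrite -[X in measurable X]setTI; exact: mM.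
by rewrite -[X in measurable X]setTI; exact: my.
Qed.

Lemma adapted_M k t : (k <= t)%N ->
  measurable_mx (M k : g_sigma_algebraType (gen_Dt M y t) -> 'M[R]_(m, n)).
Proof.
move=> kt i j _ Y mY; rewrite setTI; apply: sub_sigma_algebra.
by left; exists k, i, j, Y.
Qed.

Lemma adapted_y k t : (1 <= k <= t)%N ->
  measurable_mx (y k : g_sigma_algebraType (gen_Dt M y t) -> 'cV[R]_m).
Proof.
move=> kt i j _ Y mY; rewrite setTI; apply: sub_sigma_algebra.
by right; exists k, i, Y; split => //; split => //; rewrite [j]ord1.
Qed.

End Filtration.

Theorem theorem1 (d : measure_display) (Om : measurableType d) (R : realType)
  (P : probability Om R) (m n : nat) (T : option nat)
  (M : nat -> Om -> 'M[R]_(m, n)) (y w : nat -> Om -> 'cV[R]_m)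
  (theta : 'cV[R]_n) (W : 'M[R]_m) (cw : R) (z : 'cV[R]_n) (Pbar : 'M[R]_n)
  (delta : R) :
  (forall k (i : 'I_m) (j : 'I_n), measurable_fun setT (fun om => M k om i j)) ->
  (forall k (i : 'I_m), measurable_fun setT (fun om => y k om i 0)) ->
  (forall k (i : 'I_m), measurable_fun setT (fun om => w k om i 0)) ->
  (forall t om, leT1 T t -> y t.+1 om = M t om *m theta + w t om) ->
  spd W ->
  0 < cw ->
  (forall t, leT1 T t -> forall nu : 'cV[R]_m,
     cond_exp_le P (Dt M y t) (fun om => expR ((nu^T *m w t om) 0 0))
       (expR (2^-1 * cw ^+ 2 * qform (invmx W) nu))) ->
  spd Pbar ->
  0 < delta < 1 ->
  ((1 - delta)%:E <=
    P [set om | forall t, leT T t ->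
        (qform (invmx (Pbar + Vt W (M ^~ om) t)) (z + st W (M ^~ om) (w ^~ om) t)
        <= qform (invmx Pbar) z
           + cw ^+ 2 * (ln (\det (1%:M + invmx Pbar *m Vt W (M ^~ om) t))
                        + 2 * ln delta^-1))%R])%E.
Proof.
move=> mM my mw ywM sW cw0 subg sP /andP[d0 d1].
pose A t om := Pbar + Vt W (M ^~ om) t.
pose b t om := cw^-1 *: (z + st W (M ^~ om) (w ^~ om) t).
pose Z t om := gauss (A t om) (b t om).
pose OmG t : measurableType (sigma_display (gen_Dt M y t)) :=
  g_sigma_algebraType (gen_Dt M y t).
have sA t om : spd (A t om) by exact: spd_addVt.
have subG t (E : set (OmG t)) : measurable E -> d.-measurable (E : set Om).
  exact: sub_Dt.
have T1le k t : leT1 T t -> (k < t)%N -> leT1 T k.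
  by case: (T) => //= T' tT kt; exact: ltn_trans tT.
(* Stated through a map [f] because it is used with [f = id] for two sigma-algebras on the same
   points: that of [Om] and the one of the data up to some time. *)
have mAb d' (U : measurableType d') (f : U -> Om) t :
    (forall k, (k < t)%N -> measurable_mx (fun u => M k (f u))) ->
    (forall k, (k < t)%N -> measurable_mx (fun u => w k (f u))) ->
    measurable_mx (fun u => A t (f u)) /\ measurable_mx (fun u => b t (f u)).
  move=> mMf mwf; split.
    apply: measurable_mxD; first exact: measurable_mx_cst.
    apply: measurable_mx_sum => k; apply: measurable_mxM; last exact: mMf.
    apply: measurable_mxM; last exact: measurable_mx_cst.
    by apply: measurable_mx_tr; exact: mMf.
  apply: measurable_mxZ => //; apply: measurable_mxD; first exact: measurable_mx_cst.
  apply: measurable_mx_sum => k; apply: measurable_mxM; last exact: mwf.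
  apply: measurable_mxM; last exact: measurable_mx_cst.
  by apply: measurable_mx_tr; exact: mMf.
have mw' k : measurable_mx (w k) by move=> i j; rewrite [j]ord1; exact: mw.
have mAbOm t : measurable_mx (A t) /\ measurable_mx (b t).
  by apply: (mAb _ _ id) => k _ //; exact: mM.
have mAbG s t : leT1 T t -> (s <= t)%N ->
    measurable_mx (A s : OmG t -> _) /\ measurable_mx (b s : OmG t -> _).
  move=> tT st; apply: (mAb _ (OmG t) id) => k ks.
    by apply: adapted_M; exact: leq_trans (ltnW ks) st.
  have kt : (k < t)%N by exact: leq_trans st.
  (* The noise is not itself among the data, but for [k < t] it is recovered from [y k.+1] and
     [M k], and [k.+1 <= t] places this output among the data at time [t]. *)
  have -> : (fun om : OmG t => w k (id om)) = (fun om => y k.+1 om - M k om *m theta).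
    by apply/funext => om; rewrite (ywM _ _ (T1le _ _ tT kt)) addrC addKr.
  apply: measurable_mxB; first exact: adapted_y.
  apply: measurable_mxM; last exact: measurable_mx_cst.
  by apply: adapted_M; exact: ltnW.
have mZ t : measurable_fun setT (Z t).
  by have [mA mb] := mAbOm t; exact: measurable_gauss.
have adZ s t : leT1 T t -> (s <= t)%N -> measurable_fun setT (Z s : OmG t -> R).
  by move=> tT st; have [mA mb] := mAbG _ _ tT st; exact: measurable_gauss.
have superZ t (E : set (OmG t)) : leT1 T t -> measurable E ->
    (\int[P]_(om in E) (Z t.+1 om)%:E <= \int[P]_(om in E) (Z t om)%:E)%E.
  move=> tT mE; have mE' := subG _ _ mE.
  have [mA1 mb1] := mAbOm t.+1; have [mA2 mb2] := mAbOm t.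
  apply: (@gaussian_mixture_le_in _ Om R P _ E (A t.+1) (A t) (b t.+1) (b t)
    mE' mA1 mb1 mA2 mb2 (sA t.+1) (sA t)) => v.
  pose nu om := cw^-1 *: (W *m M t om *m v).
  (* [l] is the exponent at time [t], known given the data; the new noise enters only through [nu],
     so [freeze] applies. *)
  pose l om := (v^T *m b t om) 0 0 - 2^-1 * qform (A t om) v.
  pose X om := expR (l om + (((nu om)^T *m w t om) 0 0
    - 2^-1 * cw ^+ 2 * qform (invmx W) (nu om))).
  have stepE om : quadexp (A t.+1 om) (b t.+1 om) v = X om.
    have -> : A t.+1 om = A t om + (M t om)^T *m W *m M t om by rewrite /A VtS addrA.
    have -> : b t.+1 om = cw^-1 *: ((z + st W (M ^~ om) (w ^~ om) t)
        + (M t om)^T *m W *m w t om) by rewrite /b stS addrA.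
    by apply: quadexp_step => //; rewrite gt_eqF.
  have -> : (\int[P]_(om in E) (quadexp (A t.+1 om) (b t.+1 om) v)%:E =
      \int[P]_(om in E) (X om)%:E)%E.
    by apply: eq_integral => om _; rewrite stepE.
  have [mAt mbt] := mAbG _ _ tT (leqnn t).
  apply: (@freeze _ Om R P (gen_Dt M y t) m (w t)
    (fun nu => 2^-1 * cw ^+ 2 * qform (invmx W) nu)) => //.
  - exact: subG.
  - by move=> nu0 B mB; exact: subg.
  - by move=> nu0 nu1 cnu; apply: cvgM; [exact: cvg_cst|exact: cvg_qform].
  - apply: measurable_funB.
      exact: (measurable_mxM (@measurable_mx_cst _ (OmG t) _ _ _ v^T) mbt 0 0).
    apply: measurable_funM => //.
    exact: (measurable_qform mAt (@measurable_mx_cst _ (OmG t) _ _ _ v)).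
  - apply: measurable_mxZ => //; apply: measurable_mxM; last exact: measurable_mx_cst.
    by apply: measurable_mxM; [exact: measurable_mx_cst|exact: adapted_M].
pose g := gauss Pbar (cw^-1 *: z).
have g0 : 0 < g by exact: expR_gt0.
have Z0 om : Z 0%N om = g.
  by rewrite /Z /A /b /Vt /st !big_ord0 !addr0.
(* The process starts at the constant [g], so Ville's inequality at level [g / delta] gives [V]
   probability at most [delta]; the complement of [V] is the event of the theorem. *)
set V := [set om | exists2 t, leT T t & g / delta < Z t om].
have Z_ge0 t om : 0 <= Z t om by exact: expR_ge0.
have mV : measurable V by apply: ville_measurable => t _; exact: mZ.
have PV : (P V <= delta%:E)%E.
  have a0 : 0 < g / delta by exact: divr_gt0.
  have := ville (G := gen_Dt M y) Z_ge0 (fun t _ => mZ t) adZ superZ (ltW a0).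
  have -> : (\int[P]_om (Z 0%N om)%:E = g%:E)%E.
    under eq_integral do rewrite Z0.
    have PT : P [set: Om] = 1%E by exact: probability_setT.
    by rewrite integral_cst// [X in (_ * X)%E]PT mule1.
  rewrite -/V.
  rewrite -(fineK (fin_num_measure P _ mV)) -EFinM !lee_fin.
  by rewrite mulrAC ler_pdivrMr// ler_pM2l.
rewrite (_ : mkset _ = ~` V).
  rewrite probability_setC// -(fineK (fin_num_measure P _ mV)) lee_fin lerB//.
  by rewrite -lee_fin fineK// fin_num_measure.
have detE t om : ln (\det (1%:M + invmx Pbar *m Vt W (M ^~ om) t)) =
    ln (\det (A t om)) - ln (\det Pbar).
  have dP := spd_det_gt0 sP; have := spd_det_gt0 (sA t om).
  rewrite /A (det_addVt _ sP) pmulr_rgt0// => dI.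
  by rewrite lnM ?posrE// addrAC subrr add0r.
apply/seteqP; split => om /=.
  by move=> h [t tT]; rewrite ltNge => /negP; apply; rewrite gauss_le// -detE; exact: h.
move=> h t tT; rewrite detE -gauss_le// leNgt; apply/negP => Zt.
by apply: h; exists t.
Qed.
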